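(* Let $y:[a,b]\to\mathbb{C}$ be a continuous function whose second derivative is bounded, and let $M$ be a constant such that $|y''(x)|\le M$ on $[a,b]$ and, for $h$ sufficiently small, $|\Delta_j|\le M$ for all $j=1,\dots,n-1$, where $h=\frac{b-a}{n}$ and $\Delta_j$ is the second difference quotient defined in the context. Let $S$ be the quadratic spline (defined in the context) interpolating $y$ at the $n+1$ equidistant nodes $x_k=a+kh$, $k=0,\dots,n$, and let $D=\max_{x\in[a,b]}|y(x)-S(x)|$. Then, for $h$ sufficiently small, $$D\le M h\Big(b-a-\frac h2\Big).$$ In this way, the convergence order obtained for the spline is $o(h)$ for functions with bounded second derivative.
   Context: Definition of the spline $S$: with nodes $x_k=a+kh$, $h=\frac{b-a}{n}$, values $y_k=y(x_k)$ for $k=0,\dots,n$, and $\Delta_j=\frac{y_{j-1}-2y_j+y_{j+1}}{h^2}$ for $1\le j\le n-1$, $S$ is the function on $[a,b]$ equal on $[x_{k-1},x_k]$ ($k=1,\dots,n$) to $$P_k(x)=\frac{x-x_{k-1}}{h}y_k-\frac{x-x_k}{h}y_{k-1}+a_k(x-x_{k-1})(x-x_k),$$ where $$a_1=-\frac1n\sum_{j=1}^{n-1}(n-j)(-1)^j\Delta_j,\qquad a_k=(-1)^{k+1}\Big(a_1+\sum_{j=1}^{k-1}(-1)^j\Delta_j\Big)\quad(2\le k\le n).$$ These coefficients make $S'$ continuous at the interior nodes, and $a_1$ is the value minimizing $\sum_{k=1}^n\int_{x_{k-1}}^{x_k}[P_k(x)-p_k(x)]^2\,dx$, where $p_k(x)=\frac{x-x_{k-1}}{h}y_k-\frac{x-x_k}{h}y_{k-1}$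 is the linear interpolant on $[x_{k-1},x_k]$. *)

(* Defs.v *)
From HB Require Import structures.
From mathcomp Require Import all_boot all_order all_algebra.
From mathcomp Require Import complex.
From mathcomp Require Import all_classical all_reals all_analysis.
From mathcomp Require Import ring.

Set Implicit Arguments.
Unset Strict Implicit.
Unset Printing Implicit Defensive.

Import Order.TTheory GRing.Theory Num.Theory.
Import numFieldNormedType.Exports.
Import Normc.

Local Open Scope classical_set_scope.
Local Open Scope complex_scope.
Local Open Scope ring_scope.

Section QuadraticSpline.
Variable R : realType.
Implicit Types (a b x : R) (y f g : R -> R[i]) (n k j : nat).

(* [g] is the derivative of [f] on the closed interval [[a, b]]: the difference
   quotients are taken with [t] in [[a, b]] only, so that the derivatives at
   [a] and [b] are one-sided and the values of [f] outside [[a, b]] are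
   irrelevant. *)
Definition is_deriv_on a b f g :=
  forall x, x \in `[a, b] ->
    (f t - f x) / (t - x)%:C @[t --> within `[a, b] x^']
      --> (g x : R[i]^o).

Definition mesh a b n : R := (b - a) / n%:R.

Definition node a b n k : R := a + k%:R * mesh a b n.

(* Only used for [1 <= j <= n - 1]. *)
Definition second_diff a b y n j : R[i] :=
  (y (node a b n j.-1) - y (node a b n j) *+ 2 + y (node a b n j.+1))
    / ((mesh a b n) ^+ 2)%:C.

Definition spline_coef1 a b y n : R[i] :=
  - (n%:R^-1 * \sum_(1 <= j < n) (n - j)%:R * (-1) ^+ j * second_diff a b y n j).

(* For [k = 1] the sum is empty and this is [spline_coef1]. *)
Definition spline_coef a b y n k : R[i] :=
  (-1) ^+ k.+1 *
    (spline_coef1 a b y n + \sum_(1 <= j < k) (-1) ^+ j * second_diff a b y n j).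

(* Only used for [1 <= k <= n]. *)
Definition spline_piece a b y n k x : R[i] :=
  let h := mesh a b n in
  let xl := node a b n k.-1 in
  let xr := node a b n k in
  ((x - xl) / h)%:C * y xr - ((x - xr) / h)%:C * y xl
    + spline_coef a b y n k * ((x - xl) * (x - xr))%:C.

(* At [x] use the piece of least index [k >= 1] such that [x <= x_k]; by
   [splineE] below, the choice at the nodes does not matter. *)
Definition spline a b y n x : R[i] :=
  spline_piece a b y n
    (find (fun k => x <= node a b n k.+1) (iota 0 n)).+1 x.

Lemma mesh_gt0 a b n : a < b -> (0 < n)%N -> 0 < mesh a b n.
Proof. by move=> ab n0; rewrite divr_gt0 ?subr_gt0 ?ltr0n. Qed.

Lemma node_le a b n k j : a < b -> (0 < n)%N ->
  (node a b n k <= node a b n j) = (k <= j)%N.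
Proof. by move=> ab n0; rewrite lerD2l ler_pM2r ?mesh_gt0// ler_nat. Qed.

Lemma spline_piece_node a b y n k : a < b -> (0 < n)%N ->
  spline_piece a b y n k.+1 (node a b n k.+1) = y (node a b n k.+1).
Proof.
move=> ab n0; rewrite /spline_piece /= subrr mul0r mulr0 !rmorph0 mulr0 mul0r.
suff -> : (node a b n k.+1 - node a b n k) / mesh a b n = 1.
  by rewrite mul1r subr0 addr0.
rewrite /node -natr1; have h0 := lt0r_neq0 (mesh_gt0 ab n0).
by field.
Qed.

Lemma spline_piece_nodel a b y n k : a < b -> (0 < n)%N ->
  spline_piece a b y n k.+1 (node a b n k) = y (node a b n k).
Proof.
move=> ab n0; rewrite /spline_piece /= subrr !mul0r ?rmorph0 ?mulr0 ?mul0r.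
suff -> : (node a b n k - node a b n k.+1) / mesh a b n = -1.
  by rewrite rmorphN1 mulN1r opprK add0r addr0.
rewrite /node -natr1; have h0 := lt0r_neq0 (mesh_gt0 ab n0).
by field.
Qed.

Lemma splineE a b y n k x : a < b -> (1 <= k <= n)%N ->
  x \in `[node a b n k.-1, node a b n k] ->
  spline a b y n x = spline_piece a b y n k x.
Proof.
case: k => [//|k] ab /= kn; rewrite in_itv /= => /andP[xl xr].
have n0 : (0 < n)%N by apply: leq_ltn_trans kn.
rewrite /spline; set p := fun _ => _; set m := find p _.
have nthk i : (i < n)%N -> nth 0%N (iota 0 n) i = i by move=> ?; rewrite nth_iota.
have mk : (m <= k)%N.
  rewrite leqNgt; apply/negP => km.
  by have := before_find 0%N km; rewrite nthk // /p xr.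
have pm : p m.
  have hp : has p (iota 0 n).
    by rewrite has_find size_iota (leq_ltn_trans mk).
  by have := nth_find 0%N hp; rewrite -/m nthk // (leq_ltn_trans mk).
case: (ltngtP m k) mk => // [mk _|-> //].
have e : x = node a b n k.
  apply/eqP; rewrite eq_le xl andbT (le_trans pm) //.
  by rewrite node_le.
have ek : k = m.+1.
  apply/eqP; rewrite eqn_leq mk andbT.
  by rewrite -(node_le _ _ ab n0) -e.
by rewrite e spline_piece_nodel // ek spline_piece_node.
Qed.

(* [D] is the maximum of [|y - S|] over [[a, b]]. *)
Definition is_max_error a b y n (D : R) :=
  let E := [set normc (y x - spline a b y n x) | x in `[a, b]] in
  E D /\ ubound E D.

End QuadraticSpline.

(* Main.v *)
Require Import Defs.
From HB Require Import structures.
From mathcomp Require Import all_boot all_order all_algebra complex.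
From mathcomp Require Import all_classical all_reals all_analysis.
From mathcomp Require Import ring lra zify.
Import Order.TTheory GRing.Theory Num.Theory.
Import numFieldNormedType.Exports.
Import Normc.
Local Open Scope classical_set_scope.
Local Open Scope ring_scope.
(** Write [Delta_j] for the second difference quotients, [T_k] for the sum of
    [(-1)^j * Delta_j] over [1 <= j < k], and [h] for the mesh.  By Abel
    summation [a_1 = - (T_1 + ... + T_n) / n], so a bound [B] on all [|T_k|]
    gives [|a_k| <= 2 B], and [|y - S|] is at most the error of linear
    interpolation, which is [O(h ^ 2)], plus [B h ^ 2 / 2].  The choice
    [B = n M] yields the explicit bound.

    For the rate [o(h)] one needs [h T_k -> 0] uniformly in [k].  The mean value
    theorem turns [h T_k] into an alternating sum of increments of the Lipschitz
    function [y'] on a translated grid of step [h], for the real and imaginary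
    parts separately.  The energies [\sum (increment)^2 / step] of [y'] are
    bounded and increase under refinement, so along fine grids they converge to
    their supremum; the parallelogram identity, which compares step [h] with
    step [2 h], then shows that neighbouring increments nearly cancel.  This
    replaces the Riemann-Lebesgue lemma for [y''], which need not be Riemann
    integrable. *)

(** * Cauchy-Schwarz and block summation for finite sums *)

Lemma sqr_sum_le (R : realType) (p : nat -> R) q :
  (\sum_(0 <= i < q) p i) ^+ 2 <= q%:R * \sum_(0 <= i < q) p i ^+ 2.
Proof.
elim: q => [|q IH]; first by rewrite !big_nil expr0n mulr0.
rewrite !big_nat_recr//= -natr1.
set s := \sum_(0 <= i < q) p i in IH *.
set t := \sum_(0 <= i < q) p i ^+ 2 in IH *.
have t0 : 0 <= t by apply: sumr_ge0 => i _; exact: sqr_ge0.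
have [q0|q0] := posnP q.
  by rewrite /s /t q0 !big_nil !add0r mul1r.
have q1 : 0 < q%:R :> R by rewrite ltr0n.
suff H : 2 * (s * p q) <= t + q%:R * p q ^+ 2.
  by rewrite sqrrD -mulr_natl mulrDr mulrDl mulrDl !mul1r; lra.
rewrite -(ler_pM2l q1) (le_trans _ (_ : s ^+ 2 + (q%:R * p q) ^+ 2 <= _))//.
  by have := sqr_ge0 (s - q%:R * p q); rewrite sqrrB; lra.
by rewrite mulrDr lerD// exprMn expr2; lra.
Qed.

Lemma big_nat_blocks (R : realType) (F : nat -> R) q m :
  \sum_(0 <= i < q * m) F i =
  \sum_(0 <= j < m) \sum_(0 <= i < q) F (q * j + i)%N.
Proof.
elim: m => [|m IH]; first by rewrite muln0 !big_nil.
rewrite big_nat_recr//= -IH mulnS addnC (big_cat_nat (leq0n _) (leq_addr _ _)) /=.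
congr (_ + _); rewrite -{1}[(q * m)%N]add0n big_addn addKn.
by apply: eq_bigr => i _; rewrite addnC.
Qed.

(** * Energies of a Lipschitz function on equispaced grids *)

Section EquispacedEnergy.
Variables (R : realType) (v : R -> R) (M : R).
Hypothesis v_lip : forall s t, `|v s - v t| <= M * `|s - t|.
Implicit Types (a b c h d : R) (n m i : nat).

Definition incr c h i := v (c + i.+1%:R * h) - v (c + i%:R * h).

(** The discrete counterpart of the integral of [v' ^ 2] over [[c, c + n * h]]; it makes sense
    without any integrability of [v']. *)
Definition energy c h n := (\sum_(0 <= i < n) incr c h i ^+ 2) / h.

Lemma lip_ge0 : 0 <= M.
Proof. by have := v_lip 1 0; rewrite subr0 normr1 mulr1; apply: le_trans. Qed.

Lemma incr_le c h i : 0 < h -> `|incr c h i| <= M * h.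
Proof.
move=> h0; apply: (le_trans (v_lip _ _)).
have -> : c + i.+1%:R * h - (c + i%:R * h) = h by rewrite -natr1; ring.
by rewrite gtr0_norm.
Qed.

Lemma energy_le c h n : 0 < h -> energy c h n <= M ^+ 2 * (n%:R * h).
Proof.
move=> h0; rewrite ler_pdivrMr//.
have : \sum_(0 <= i < n) incr c h i ^+ 2 <= \sum_(0 <= i < n) (M * h) ^+ 2.
  apply: ler_sum => i _; rewrite -(real_normK (num_real (incr c h i))).
  by rewrite lerXn2r ?incr_le// nnegrE// mulr_ge0 ?lip_ge0// ltW.
by move/le_trans; apply; rewrite big_const_nat iter_addr_0 subn0 -mulr_natl; lra.
Qed.

Lemma incr_block c h q j :
  incr c (q%:R * h) j = \sum_(0 <= i < q) incr c h (q * j + i).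
Proof.
rewrite (eq_bigr (fun i => v (c + (q * j + i.+1)%:R * h) - v (c + (q * j + i)%:R * h))).
  rewrite telescope_sumr// addn0 -mulnSr /incr.
  by rewrite !natrM [_%:R * (_ * h)]mulrA [j%:R * _]mulrA ![_ * q%:R]mulrC.
by move=> i _; rewrite /incr addnS.
Qed.

(** Cauchy-Schwarz on each block of [q] increments loses a factor [q], which the larger step [q * h]
    in the denominator compensates. *)
Lemma energy_coarsen c h q m : 0 < h -> (0 < q)%N ->
  energy c (q%:R * h) m <= energy c h (q * m).
Proof.
move=> h0 q0; have q1 : 0 < q%:R :> R by rewrite ltr0n.
rewrite /energy ler_pdivrMr ?mulr_gt0// [leRHS]mulrCA divfK ?gt_eqF//.
rewrite big_nat_blocks mulr_sumr; apply: ler_sum => j _.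
by rewrite incr_block sqr_sum_le.
Qed.

Lemma energy_sub c h i0 m n : 0 < h -> (i0 + m <= n)%N ->
  energy (c + i0%:R * h) h m <= energy c h n.
Proof.
move=> h0 mn; rewrite ler_pM2r ?invr_gt0//.
rewrite (@big_cat_nat _ _ _ i0 0 n)//= ?(leq_trans (leq_addr _ _) mn)//.
rewrite (@big_cat_nat _ _ _ (i0 + m) i0 n)//= ?leq_addr//.
have p0 k l : 0 <= \sum_(k <= i < l) incr c h i ^+ 2.
  by apply: sumr_ge0 => i _; exact: sqr_ge0.
rewrite -[X in X <= _]add0r lerD// -[X in X <= _]addr0 lerD//.
rewrite -{2}[i0]add0n big_addn addKn.
apply: ler_sum => i _; rewrite le_eqVlt; apply/orP; left; apply/eqP.
congr (_ ^+ 2); rewrite /incr; congr (v _ - v _).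
  by rewrite -addSn natrD; ring.
by rewrite natrD; ring.
Qed.

Lemma energy_perturb c c' d d' m (e : R) : 0 < d' -> d' <= d ->
  `|c' - c| <= e -> `|d' - d| <= e ->
  energy c d m <= energy c' d' m + 4 * M ^+ 2 * (m * m.+1)%:R * e.
Proof.
move=> d'0 d'd ce de; have d0 := lt_le_trans d'0 d'd.
have M0 := lip_ge0.
have e0 : 0 <= e by apply: le_trans ce.
have step i : (i < m)%N ->
    incr c d i ^+ 2 <= incr c' d' i ^+ 2 + 4 * M ^+ 2 * m.+1%:R * e * d.
  move=> im.
  have pt k : (k <= m)%N ->
      `|v (c' + k%:R * d') - v (c + k%:R * d)| <= M * (m.+1%:R * e).
    move=> km; apply: (le_trans (v_lip _ _)); rewrite ler_wpM2l//.
    have -> : c' + k%:R * d' - (c + k%:R * d) = (c' - c) + k%:R * (d' - d) by ring.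
    apply: (le_trans (ler_normD _ _)); rewrite normrM normr_nat -natr1.
    rewrite mulrDl mul1r addrC lerD// ler_pM// ler_nat//.
  have H : `|incr c' d' i - incr c d i| <= 2 * M * m.+1%:R * e.
    have -> : incr c' d' i - incr c d i =
        (v (c' + i.+1%:R * d') - v (c + i.+1%:R * d))
        - (v (c' + i%:R * d') - v (c + i%:R * d)) by rewrite /incr; ring.
    apply: (le_trans (ler_normB _ _)).
    by have := pt _ im; have := pt _ (ltnW im); lra.
  have Hp := incr_le c d i d0.
  set p := incr c d i in H Hp *; set p' := incr c' d' i in H *.
  have P : `|p * (p' - p)| <= M * d * (2 * M * m.+1%:R * e).
    by rewrite normrM ler_pM.
  have : p' ^+ 2 = p ^+ 2 + 2 * (p * (p' - p)) + (p' - p) ^+ 2 by ring.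
  have := sqr_ge0 (p' - p); move: P; rewrite ler_norml => /andP[P _].
  move=> ? ->; nra.
rewrite /energy ler_pdivrMr//.
apply: le_trans (_ : \sum_(0 <= i < m)
   (incr c' d' i ^+ 2 + 4 * M ^+ 2 * m.+1%:R * e * d) <= _).
  by apply: ler_sum_nat => i /andP[_ im]; exact: step.
rewrite big_split/= big_const_nat iter_addr_0 subn0 -mulr_natl [leRHS]mulrDl lerD//.
  rewrite -mulrA ler_peMr//; last by rewrite ler_pdivlMl// mulr1.
  by apply: sumr_ge0 => i _; exact: sqr_ge0.
by rewrite natrM; lra.
Qed.

(** A fine grid that nearly exhausts [[a, b]] contains, after merging cells in blocks of [q], a grid
    close to the fixed one. Coarsening and restriction do not raise the energy, and the perturbation
    costs only a multiple of [h]. *)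
Lemma energy_snap a b c0 d m (e : R) : 0 < d -> a <= c0 -> c0 + m%:R * d <= b ->
  0 < e ->
  exists2 h0 : R, 0 < h0 & forall c h n, 0 < h -> h < h0 ->
    a <= c -> c <= a + h -> b - h <= c + n%:R * h ->
    energy c0 d m < energy c h n + e.
Proof.
move=> d0 ac0 c0b e0; have M0 := lip_ge0.
case: m c0b => [_|m c0b].
  exists 1 => // c h n h0 _ _ _ _; rewrite {1}/energy big_nil mul0r.
  rewrite ltr_wpDl// divr_ge0 ?(ltW h0)//.
  by apply: sumr_ge0 => i _; exact: sqr_ge0.
set K := 4 * M ^+ 2 * (m.+1 * m.+2)%:R * 3.
have K0 : 0 <= K by rewrite !mulr_ge0// exprn_ge0.
exists (Num.min (d / 4) (e / (K + 1))).
  by rewrite lt_min !divr_gt0// ltr_wpDl.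
move=> c h n h0; rewrite lt_min => /andP[hd he] ac ca nb.
have K1 : 0 < K + 1 by rewrite ltr_wpDl.
rewrite ltr_pdivlMr// in he; rewrite ltr_pdivlMr// in hd.
(* If [c0 < c], truncation gives [i0 = 0]; the starting points are still within [h], because
   [c <= a + h <= c0 + h]. *)
pose i0 := Num.truncn ((c0 - c) / h).
(* This puts [q * h] between [d - 3 * h] and [d - 2 * h]. The loss of at least [2 * h] per cell pays
   for the shift of the starting point and for the gap left at [b], so the blocks fit into the [n]
   cells. *)
pose q := Num.truncn (d / h - 2).
have dh : 4 < d / h by rewrite ltr_pdivlMr// mulrC.
have /andP[q1 q2] : q%:R <= d / h - 2 < q.+1%:R by apply: truncn_itv; lra.
have ql : q%:R * h <= d - 2 * h by rewrite -ler_pdivlMr// mulrBl mulfK ?gt_eqF.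
have qg : d - 3 * h < q%:R * h.
  rewrite -ltr_pdivrMr// mulrBl mulfK ?gt_eqF//.
  by move: q2; rewrite -natr1; lra.
have q0 : (0 < q)%N by rewrite /q truncn_gt0; lra.
have i1 : c0 - c < i0.+1%:R * h by rewrite -ltr_pdivrMr//; exact: truncnS_gt.
have i2 : i0%:R * h <= Num.max 0 (c0 - c).
  have [H|H] := leP 0 (c0 - c).
    by rewrite -ler_pdivlMr// truncn_le divr_ge0// ltW.
  rewrite /i0 (_ : Num.truncn _ = 0%N) ?mul0r//.
  apply/eqP; rewrite -leqn0 leqNgt truncn_gt0 -ltNge.
  by rewrite ltr_pdivrMr// mul1r (lt_trans H).
have ci : `|c + i0%:R * h - c0| <= h.
  rewrite ler_norml; move: i1; rewrite -natr1 mulrDl mul1r => i1.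
  apply/andP; split; first lra.
  by move: i2; rewrite le_max => /orP[]; lra.
have iqn : (i0 + q * m.+1 <= n)%N.
  rewrite -(ler_nat R) -(ler_pM2r h0) natrD natrM mulrDl.
  move: ci; rewrite ler_norml => /andP[_ ci].
  have : m.+1%:R * (q%:R * h) <= m.+1%:R * (d - 2 * h) by rewrite ler_wpM2l.
  have : h <= m.+1%:R * h by rewrite ler_peMl ?ler1n// ltW.
  lra.
apply: (le_lt_trans (energy_perturb c0 (c + i0%:R * h) d (q%:R * h) m.+1 (3 * h)
  _ _ _ _)).
- by rewrite mulr_gt0// ltr0n.
- lra.
- lra.
- by rewrite ler_norml; apply/andP; split; lra.
apply: ler_ltD.
  exact: le_trans (energy_coarsen _ _ _ _ h0 q0) (energy_sub _ _ _ _ _ h0 iqn).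
by rewrite mulrA -/K; lra.
Qed.

(** On each pair of neighbouring increments, [(q - p)^2 = 2 (p^2 + q^2) - (p + q)^2], and [p + q] is
    an increment of step [2 * h]. *)
Lemma energy_parallelogram c h n : 0 < h ->
  \sum_(0 <= i < n) (incr c h (2 * i).+1 - incr c h (2 * i)) ^+ 2 =
  2 * h * (energy c h (2 * n) - energy c (2 * h) n).
Proof.
move=> h0; rewrite /energy big_nat_blocks mulrBr.
have -> : 2 * h * ((\sum_(0 <= j < n) \sum_(0 <= i < 2) incr c h (2 * j + i) ^+ 2) / h)
   = 2 * \sum_(0 <= j < n) \sum_(0 <= i < 2) incr c h (2 * j + i) ^+ 2.
  by field; rewrite gt_eqF.
rewrite [2 * h * _]mulrC divfK ?mulf_neq0 ?gt_eqF//.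
rewrite mulr_sumr -sumrB; apply: eq_bigr => i _.
rewrite (incr_block c h 2 i) !big_nat_recr//= !big_nil !add0r addn0 addn1.
by ring.
Qed.

Lemma alternating_sum_pairs c h n :
  \sum_(0 <= i < 2 * n) (-1) ^+ i.+1 * incr c h i =
  \sum_(0 <= i < n) (incr c h (2 * i).+1 - incr c h (2 * i)).
Proof.
rewrite big_nat_blocks; apply: eq_bigr => i _.
rewrite !big_nat_recr//= !big_nil !add0r addn0 addn1.
by rewrite !exprS exprM sqrrN expr1n expr1n; ring.
Qed.

(* The energies of all fine grids that nearly exhaust [[a, b]] are close to
   their supremum, in particular those of steps [h] and [2 * h]; the
   parallelogram identity then bounds the differences of neighbouring
   increments in mean square. *)
Lemma alternating_incr_small a b (e : R) : a < b -> 0 < e ->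
  exists2 h0 : R, 0 < h0 & forall c h n, 0 < h -> h < h0 ->
    a <= c -> c <= a + h -> c + n%:R * h <= b -> b <= c + n.+1%:R * h ->
    forall k, (k <= n)%N ->
      `|\sum_(0 <= i < k) (-1) ^+ i.+1 * incr c h i| <= e.
Proof.
move=> ab e0; have M0 := lip_ge0.
pose E := [set x : R | exists c d m,
  [/\ 0 < d, a <= c, c + m%:R * d <= b & x = energy c d m]].
have hsE : has_sup E.
  split; first by exists (energy a 1 0), a, 1, 0%N; split=> //; rewrite mul0r addr0 ltW.
  exists (M ^+ 2 * (b - a)) => _ [c [d [m [d0 ac cb ->]]]].
  apply: (le_trans (energy_le _ _ _ d0)); rewrite ler_wpM2l ?exprn_ge0//; lra.
(* Chosen so that Cauchy-Schwarz over [N] pairs, with [N * (2 * h) <= b - a], bounds the squared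
   alternating sum by [(b - a) * eps = (e / 2) ^+ 2]. *)
pose eps := e ^+ 2 / (4 * (b - a)).
have ba0 : 0 < b - a by rewrite subr_gt0.
have eps0 : 0 < eps / 2 by rewrite !divr_gt0 ?exprn_gt0// mulr_gt0.
have [_ [c0 [d0 [m0 [d00 ac0 c0b ->]]]] Ec0] := sup_adherent eps0 hsE.
have [h0 h00 snap] := energy_snap _ _ _ _ _ _ d00 ac0 c0b eps0.
have M1 : 0 < 2 * (M + 1) by rewrite mulr_gt0// ltr_wpDl.
(* The first bound is halved because [snap] is applied with step [2 * h]; the second makes a single
   increment at most [e / 2], for the term left unpaired when [k] is odd. *)
exists (Num.min (h0 / 2) (e / (2 * (M + 1)))).
  by rewrite lt_min !divr_gt0.
move=> c h n hp; rewrite lt_min ltr_pdivlMr// ltr_pdivlMr// => /andP[hh0 he].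
move=> ac ca cb bc k kn.
have sq_le N : (2 * N <= n)%N ->
    \sum_(0 <= i < N) (incr c h (2 * i).+1 - incr c h (2 * i)) ^+ 2 <= 2 * h * eps.
  move=> Nn; pose N1 := n./2.
  have NN : (N <= N1)%N by rewrite geq_half_double -mul2n.
  apply: (@le_trans _ _ (\sum_(0 <= i < N1)
      (incr c h (2 * i).+1 - incr c h (2 * i)) ^+ 2)).
    rewrite [leRHS](@big_cat_nat _ _ _ N)//= lerDl.
    by apply: sumr_ge0 => i _; exact: sqr_ge0.
  rewrite energy_parallelogram// ler_pM2l ?mulr_gt0//.
  have N1n : (2 * N1 <= n)%N by rewrite mul2n -geq_half_double.
  have U : energy c h (2 * N1) <= sup E.
    apply: sup_upper_bound => //; exists c, h, (2 * N1)%N; split=> //.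
    by apply: le_trans cb; rewrite lerD2l ler_pM2r// ler_nat.
  have L : energy c0 d0 m0 < energy c (2 * h) N1 + eps / 2.
    apply: snap; rewrite ?mulr_gt0//; try lra.
    have : n.+1%:R <= 2 * N1%:R + 2 :> R.
      by rewrite -natrM -(natrD _ _ 2%N) ler_nat addn2 ltnS mul2n -leq_half_double.
    by rewrite -(ler_pM2r hp); lra.
  lra.
pose N := k./2.
have Nn : (2 * N <= n)%N by rewrite mul2n -geq_half_double half_leq.
have pairs : `|\sum_(0 <= i < 2 * N) (-1) ^+ i.+1 * incr c h i| <= e / 2.
  rewrite alternating_sum_pairs; set s := \sum_(_ <= _ < _) _.
  have e20 : 0 <= e / 2 by rewrite divr_ge0// ltW.
  rewrite -(@ler_pXn2r _ 2)// ?nnegrE// real_normK ?num_real//.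
  apply: (le_trans (sqr_sum_le _ _ _)).
  apply: (le_trans (ler_wpM2l (ler0n _ _) (sq_le _ Nn))).
  have H : N%:R * (2 * h) <= b - a.
    have : (2 * N)%:R * h <= n%:R * h by rewrite ler_pM2r// ler_nat.
    by rewrite natrM; lra.
  apply: (@le_trans _ _ ((b - a) * eps)).
    by rewrite mulrA ler_wpM2r//; lra.
  rewrite le_eqVlt; apply/orP; left; apply/eqP; rewrite /eps; field.
  by rewrite gt_eqF.
have last i : `|(-1) ^+ i.+1 * incr c h i| <= e / 2.
  rewrite normrM normrX normrN1 expr1n mul1r.
  by apply: (le_trans (incr_le c h i hp)); nra.
have [->|->] : k = (2 * N)%N \/ k = (2 * N).+1.
    by have := odd_double_half k; rewrite mul2n; case: odd => <-; [right|left].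
  by apply: (le_trans pairs); lra.
rewrite big_nat_recr//=; apply: (le_trans (ler_normD _ _)).
by have := last (2 * N)%N; lra.
Qed.

End EquispacedEnergy.

(** * Projection of the line onto [[a, b]] *)

Section Clamp.
Variables (R : realType) (a b : R).
Hypothesis ab : a <= b.

(** Composition with [clamp] extends a function from [[a, b]] by constants, so that theorems about
    functions on the whole line apply. *)
Definition clamp (x : R) : R := Num.max a (Num.min b x).

Lemma clamp_itv x : clamp x \in `[a, b].
Proof. by rewrite in_itv/= /clamp le_max lexx/= ge_max ab ge_min lexx. Qed.

Lemma clamp_id x : x \in `[a, b] -> clamp x = x.
Proof. by rewrite in_itv/= /clamp => /andP[ax xb]; rewrite min_r// max_r. Qed.

Lemma clamp_lip x t : `|clamp x - clamp t| <= `|x - t|.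
Proof.
wlog xt : x t / x <= t.
  move=> H; have [|/ltW] := leP x t; first exact: H.
  by rewrite distrC [`|x - t|]distrC; exact: H.
rewrite [`|x - t|]distrC (ger0_norm (_ : 0 <= t - x)) ?subr_ge0// ler_norml /clamp.
move: ab xt; rewrite /Num.min; do 2 case: ltP => ?; rewrite /Num.max.
all: by do 2 case: ltP => ?; move=> *; apply/andP; split; lra.
Qed.

End Clamp.

(** * Mean value estimates for derivatives on a closed interval *)

Section RealDerivative.
Variables (R : realType) (a b : R).
Hypothesis ab : a < b.
Implicit Types (f g u v w : R -> R) (x t M : R).

Definition real_deriv_on f g := forall x, x \in `[a, b] -> forall e, 0 < e ->
  exists2 d : R, 0 < d & forall t, t \in `[a, b] -> t != x -> `|t - x| < d ->
    `|(f t - f x) / (t - x) - g x| < e.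

(** Close to a point [c] of [[a, b]] the difference quotients stay below [|g c| + 1] in modulus, and
    [clamp] does not increase distances. *)
Lemma clamp_continuous f g : real_deriv_on f g ->
  continuous (f \o clamp R a b).
Proof.
move=> fg x; have cx := clamp_itv R a b (ltW ab) x.
have [d d0 H] := fg _ cx _ (@ltr01 R).
set c := clamp R a b x in cx H *.
have K0 : 0 < `|g c| + 1 by rewrite ltr_wpDl.
apply/cvgrPdist_lt => /= e e0; near=> t.
have ct := clamp_itv R a b (ltW ab) t.
have cd : `|clamp R a b t - c| <= `|t - x| by exact: (clamp_lip R a b (ltW ab)).
rewrite distrC; set s := clamp R a b t in ct cd *.
have [->|sc] := eqVneq s c; first by rewrite subrr normr0.
have td : `|t - x| < Num.min d (e / (`|g c| + 1)).
  rewrite distrC; near: t; apply: (@cvgr_dist_lt _ _ _ _ _ id) => //.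
  by rewrite lt_min d0 divr_gt0.
move: td; rewrite lt_min => /andP[td te].
have {}H := H _ ct sc (le_lt_trans cd td).
have sc0 : 0 < `|s - c| by rewrite normr_gt0 subr_eq0.
have -> : f s - f c = (f s - f c) / (s - c) * (s - c).
  by rewrite divfK// subr_eq0.
rewrite normrM.
have : `|(f s - f c) / (s - c)| < `|g c| + 1.
  have := ler_normD ((f s - f c) / (s - c) - g c) (g c); rewrite subrK.
  by move=> /le_lt_trans; apply; rewrite addrC ltrD2l.
rewrite -(ltr_pM2r sc0) => /lt_le_trans; apply.
rewrite -ler_pdivlMl// mulrC; exact: le_trans cd (ltW te).
Unshelve. all: by end_near. Qed.

Lemma clamp_is_derive f g x : real_deriv_on f g -> x \in `]a, b[ ->
  is_derive x 1 (f \o clamp R a b) (g x).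
Proof.
move=> fg xab; move: (xab); rewrite in_itv/= => /andP[ax xb].
have xI : x \in `[a, b] by rewrite in_itv/= !ltW.
have cv : h^-1 *: ((f \o clamp R a b) (h *: 1 + x) - (f \o clamp R a b) x)
    @[h --> 0^'] --> g x.
  apply/cvgrPdist_lt => e e0; have [d d0 H] := fg _ xI _ e0.
  near=> h; have h0 : h != 0 by near: h; exact: nbhs_dnbhs_neq.
  have : `|h| < Num.min d (Num.min (x - a) (b - x)).
    near: h; apply: dnbhs0_lt; by rewrite !lt_min d0 !subr_gt0 ax xb.
  rewrite !lt_min => /and3P[hd /ltr_normlP[h1 h2] /ltr_normlP[h3 h4]].
  have hI : h + x \in `[a, b].
    rewrite in_itv/=; apply/andP; split; lra.
  have := H (h + x) hI; rewrite addrK; rewrite -subr_eq0 addrK => /(_ h0 hd).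
  by rewrite distrC /= [h%:A]mulr1 !clamp_id// mulrC.
apply: DeriveDef; first exact: cvgP cv.
exact: cvg_lim cv.
Unshelve. all: by end_near. Qed.

Lemma clamp_lipschitz v w M : real_deriv_on v w ->
  (forall x, x \in `[a, b] -> `|w x| <= M) ->
  forall s t, `|(v \o clamp R a b) s - (v \o clamp R a b) t| <= M * `|s - t|.
Proof.
move=> vw wM s t.
have M0 : 0 <= M.
  have := wM a; rewrite in_itv/= lexx ltW// => /(_ isT).
  by apply: le_trans.
wlog st : s t / clamp R a b s <= clamp R a b t.
  move=> H; have [|/ltW] := leP (clamp R a b s) (clamp R a b t); first exact: H.
  by rewrite distrC [`|s - t|]distrC; exact: H.
have cs := clamp_itv R a b (ltW ab) s; have ct := clamp_itv R a b (ltW ab) t.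
have := clamp_lip R a b (ltW ab) s t.
rewrite /=; set x := clamp R a b s in st cs *; set z := clamp R a b t in st ct *.
have [||z0 zI e] := MVT_segment (f := v \o clamp R a b) (df := w) st.
  move=> p pI; apply: clamp_is_derive => //.
  move: pI cs ct; rewrite !in_itv/= => /andP[xp pz] /andP[ax _] /andP[_ zb].
  by rewrite (le_lt_trans ax) ?(lt_le_trans pz).
  by apply: continuous_subspaceT; exact: (clamp_continuous _ _ vw).
move=> xz; rewrite distrC.
move: e; rewrite /= !clamp_id// => ->; rewrite normrM distrC.
have z0I : z0 \in `[a, b].
  move: zI cs ct; rewrite !in_itv/= => /andP[xp pz] /andP[ax _] /andP[_ zb].
  by rewrite (le_trans ax) ?(le_trans pz).
by rewrite ler_pM// wM.
Qed.

(** Two applications of the mean value theorem write the error as [(v c1 - v c2) * (x - xl)] with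
    [c1] and [c2] in [[xl, xr]]. The constant is cruder than the classical [M / 8]. *)
Lemma linear_interp_error u v M xl xr x : continuous u ->
  (forall t, t \in `]a, b[ -> is_derive t 1 u (v t)) ->
  (forall s t, `|v s - v t| <= M * `|s - t|) ->
  a <= xl -> xl < xr -> xr <= b -> x \in `[xl, xr] ->
  `|u x - ((x - xl) / (xr - xl) * u xr - (x - xr) / (xr - xl) * u xl)|
    <= M * (xr - xl) ^+ 2.
Proof.
move=> uc uv vM al lr rb; rewrite in_itv/= => /andP[lx rx].
have M0 : 0 <= M by have := vM 1 0; rewrite subr0 normr1 mulr1; apply: le_trans.
have mvt s t : xl <= s -> s <= t -> t <= xr ->
    exists2 c, c \in `[s, t] & u t - u s = v c * (t - s).
  move=> ls st tr.
  have uv' p : p \in `]s, t[ -> is_derive p 1 u (v p).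
    rewrite in_itv/= => /andP[sp pt]; apply: uv; rewrite in_itv/=.
    by rewrite (le_lt_trans _ sp) ?(lt_le_trans pt)// (le_trans al, le_trans tr).
  have uc' : {within `[s, t], continuous u}.
    by apply: continuous_subspaceT; exact: uc.
  by have [c cI e] := MVT_segment st uv' uc'; exists c.
have [c1 c1I e1] := mvt xl x (lexx _) lx rx.
have [c2 c2I e2] := mvt xl xr (lexx _) (ltW lr) (lexx _).
have h0 : xr - xl != 0 by rewrite gt_eqF// subr_gt0.
have -> : u x - ((x - xl) / (xr - xl) * u xr - (x - xr) / (xr - xl) * u xl) =
    (u x - u xl) - (u xr - u xl) * (x - xl) / (xr - xl) by field.
rewrite e1 e2 mulrAC mulfK// -mulrBl normrM expr2 mulrA.
move: c1I c2I; rewrite !in_itv/= => /andP[c1l c1r] /andP[c2l c2r].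
apply: ler_pM => //; last by rewrite ger0_norm ?subr_ge0//; lra.
apply: (le_trans (vM _ _)); rewrite ler_wpM2l// ler_norml.
by apply/andP; split; lra.
Qed.

Lemma is_derive_sum_nat (F dF : nat -> R -> R) k x :
  (forall i, (i < k)%N -> is_derive x 1 (F i) (dF i x)) ->
  is_derive x 1 (fun t => \sum_(0 <= i < k) F i t) (\sum_(0 <= i < k) dF i x).
Proof.
elim: k => [_|k IH H].
  rewrite big_nil (_ : (fun t => _) = cst 0); first exact: is_derive_cst.
  by apply/funext => t; rewrite big_nil.
rewrite big_nat_recr//= (_ : (fun t => _) =
  (fun t => \sum_(0 <= i < k) F i t) + F k).
  apply: is_deriveD; last exact: H.
  by apply: IH => i ik; apply: H; rewrite ltnS ltnW.
by apply/funext => t; rewrite big_nat_recr.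
Qed.

Lemma continuous_sum_nat (F : nat -> R -> R) k :
  (forall i, continuous (F i)) -> continuous (fun t => \sum_(0 <= i < k) F i t).
Proof.
move=> FC; elim: k => [|k IH] x.
  rewrite (_ : (fun t => _) = cst 0); first exact: cvg_cst.
  by apply/funext => t; rewrite big_nil.
rewrite (_ : (fun t => _) = (fun t => \sum_(0 <= i < k) F i t + F k t)).
  by apply: cvgD; [exact: IH|exact: FC].
by apply/funext => t; rewrite big_nat_recr.
Qed.

Lemma is_derive_translate u v c x : is_derive (c + x) 1 u (v (c + x)) ->
  is_derive x 1 (fun t => u (c + t)) (v (c + x)).
Proof.
move=> H.
have D : is_derive x 1 (fun t : R => c + t) (1 : R).
  by rewrite -[X in is_derive _ _ _ X]add0r; apply: is_deriveD.
by have := is_derive1_comp H D; rewrite mulr1.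
Qed.

(* The mean value theorem is applied to the whole alternating sum
   [G t = \sum_i (-1) ^+ i.+1 * (u (x_(i+1) + t) - u (x_i + t))] at once, so that
   all increments of [v] are taken on one translated grid. *)
Lemma alternating_second_diff u v h k : continuous u ->
  (forall t, t \in `]a, b[ -> is_derive t 1 u (v t)) ->
  0 < h -> a + k.+1%:R * h <= b ->
  exists2 tau, tau \in `]0, h[ &
    \sum_(0 <= i < k) (-1) ^+ i.+1 *
      (u (a + i%:R * h) - u (a + i.+1%:R * h) *+ 2 + u (a + i.+2%:R * h)) =
    h * \sum_(0 <= i < k) (-1) ^+ i.+1 * incr R v (a + tau) h i.
Proof.
move=> uc uv h0 kb.
pose F i t := (-1) ^+ i.+1 * (u (a + i.+1%:R * h + t) - u (a + i%:R * h + t)).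
pose dF i t := (-1) ^+ i.+1 * (v (a + i.+1%:R * h + t) - v (a + i%:R * h + t)).
pose G t := \sum_(0 <= i < k) F i t.
have Gc : continuous G.
  apply: continuous_sum_nat => i t; apply: cvgMr; apply: cvgB.
    by apply: continuous_comp; [exact: cvgD (cvg_cst _) cvg_id|exact: uc].
  by apply: continuous_comp; [exact: cvgD (cvg_cst _) cvg_id|exact: uc].
have Gd t : t \in `]0, h[ -> is_derive t 1 G (\sum_(0 <= i < k) dF i t).
  rewrite in_itv/= => /andP[t0 th]; apply: is_derive_sum_nat => i ik.
  have D j : (j <= k)%N ->
      is_derive t 1 (fun t => u (a + j%:R * h + t)) (v (a + j%:R * h + t)).
    move=> jk; apply: is_derive_translate; apply: uv; rewrite in_itv/=.
    have : j%:R * h <= k%:R * h by rewrite ler_pM2r// ler_nat.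
    have : 0 <= j%:R * h by rewrite mulr_ge0// ltW.
    by move: kb; rewrite -natr1 mulrDl mul1r => *; apply/andP; split; lra.
  by apply: is_deriveZ; apply: is_deriveB; apply: D => //; exact: ltnW.
have Gw : {within `[0, h], continuous G} by exact: continuous_subspaceT.
have [tau tI e] := MVT h0 Gd Gw.
exists tau => //; rewrite mulrC.
(* A shift by [h] moves every grid point to the next one, so the change of a first difference from
   [0] to [h] is a second difference. *)
transitivity (G h - G 0).
  rewrite /G -sumrB; apply: eq_bigr => i _; rewrite /F.
  rewrite !addr0 (_ : a + i.+1%:R * h + h = a + i.+2%:R * h); last first.
    by rewrite -[i.+2%:R]natr1; ring.
  rewrite (_ : a + i%:R * h + h = a + i.+1%:R * h); last by rewrite -[i.+1%:R]natr1; ring.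
  by rewrite mulr2n; ring.
rewrite e subr0; congr (_ * _); apply: eq_bigr => i _; rewrite /dF /incr.
by congr (_ * (v _ - v _)); ring.
Qed.

End RealDerivative.

(** * Estimates through a real-linear contraction [P], later [Re] or [Im] *)

Section ComplexProjection.
Variables (R : realType) (P : R[i] -> R).
Hypothesis PB : {morph P : z w / z - w}.
Hypothesis PZ : forall (r : R) z, P (r%:C%C * z) = r * P z.
Hypothesis P_le : forall z, `|P z| <= normc z.
Implicit Types (a b x e M : R) (y : R -> R[i]) (n k j : nat).

Lemma proj0 : P 0 = 0.
Proof. by rewrite -(subrr 0) PB subrr. Qed.

Lemma projD : {morph P : z w / z + w}.
Proof. by move=> z w; rewrite -{1}(opprK w) -(sub0r w) !PB proj0 sub0r opprK. Qed.

Lemma proj_sum (I : Type) (r : seq I) (F : I -> R[i]) :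
  P (\sum_(i <- r) F i) = \sum_(i <- r) P (F i).
Proof. exact: (big_morph P projD proj0). Qed.

Lemma proj_sign m z : P ((-1) ^+ m * z) = (-1) ^+ m * P z.
Proof. by rewrite -PZ rmorphXn rmorphN1. Qed.

Lemma projV (r : R) z : P (z / r%:C%C) = P z / r.
Proof. by rewrite mulrC -fmorphV PZ mulrC. Qed.

Lemma normc_lt_real (z : R[i]) e : (`|z| < e%:C%C) = (normc z < e).
Proof. by rewrite normc_def ltcR; case: z. Qed.

Lemma proj_deriv_on a b y y' : is_deriv_on a b y y' ->
  real_deriv_on R a b (P \o y) (P \o y').
Proof.
move=> yy x xI e e0; 
have := iffLR (@cvgrPdist_lt R[i] R[i]^o _ _ _ _ _) (yy x xI) e%:C%C; rewrite ltcR => /(_ _ e0).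
rewrite near_withinE => H; move: H; rewrite near_withinE => /nbhs_ballP[d /= d0 H].
exists d => // t tI tx td.
have := H t; rewrite /ball/= distrC => /(_ td tx tI).
rewrite normc_lt_real => /(le_lt_trans (P_le _)).
by rewrite PB projV PB distrC.
Qed.

(** These are the sums [T_k]. *)
Definition alternating_diffs a b y n k : R[i] :=
  \sum_(1 <= j < k) (-1) ^+ j * second_diff a b y n j.

Section Estimates.
Variables (a b M : R) (y y' y'' : R -> R[i]).
Hypothesis ab : a < b.
Hypothesis y_deriv : is_deriv_on a b y y'.
Hypothesis y'_deriv : is_deriv_on a b y' y''.
Hypothesis y''_le : forall x, x \in `[a, b] -> normc (y'' x) <= M.

Let u := P \o y \o clamp R a b.
Let v := P \o y' \o clamp R a b.

Lemma proj_continuous : continuous u.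
Proof. exact: (clamp_continuous R a b ab _ _ (proj_deriv_on _ _ _ _ y_deriv)). Qed.

Lemma proj_is_derive t : t \in `]a, b[ -> is_derive t 1 u (v t).
Proof.
move=> tI; rewrite /v /= clamp_id; last first.
  by move: tI; rewrite !in_itv/= => /andP[? ?]; rewrite !ltW.
exact: (clamp_is_derive R a b _ _ _ (proj_deriv_on _ _ _ _ y_deriv) tI).
Qed.

Lemma proj_lipschitz s t : `|v s - v t| <= M * `|s - t|.
Proof.
apply: (clamp_lipschitz R a b ab _ (P \o y'')).
  exact: proj_deriv_on.
by move=> x xI; exact: le_trans (P_le _) (y''_le _ xI).
Qed.

Lemma mesh_mul n : (0 < n)%N -> n%:R * mesh a b n = b - a.
Proof. by move=> n0; rewrite /mesh mulrC divfK// pnatr_eq0 -lt0n. Qed.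

Lemma node_itv n k : (0 < n)%N -> (k <= n)%N -> node a b n k \in `[a, b].
Proof.
move=> n0 kn; have h0 := mesh_gt0 ab n0; have := mesh_mul n n0.
have : k%:R * mesh a b n <= n%:R * mesh a b n by rewrite ler_pM2r// ler_nat.
have : 0 <= k%:R * mesh a b n by rewrite mulr_ge0// ltW.
by rewrite in_itv/= /node => ? ? ?; apply/andP; split; lra.
Qed.

Lemma nodeS n k : node a b n k.+1 - node a b n k = mesh a b n.
Proof. by rewrite /node -natr1; ring. Qed.

Lemma proj_interp_error n k x : (0 < n)%N -> (k < n)%N ->
  x \in `[node a b n k, node a b n k.+1] ->
  `|P (y x - (((x - node a b n k) / mesh a b n)%:C%C * y (node a b n k.+1)
             - ((x - node a b n k.+1) / mesh a b n)%:C%C * y (node a b n k)))|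
    <= M * mesh a b n ^+ 2.
Proof.
move=> n0 kn xI; have h0 := mesh_gt0 ab n0.
have lI := node_itv _ _ n0 (ltnW kn); have rI := node_itv _ _ n0 kn.
have := lI; have := rI; rewrite !in_itv/= => /andP[_ rb] /andP[al _].
have lr : node a b n k < node a b n k.+1 by rewrite -subr_gt0 nodeS.
have := linear_interp_error R a b u v M _ _ x proj_continuous
  proj_is_derive proj_lipschitz al lr rb xI.
rewrite nodeS /u /= !clamp_id//; last first.
  move: xI; rewrite !in_itv/= => /andP[lx xr].
  by rewrite (le_trans al) ?(le_trans xr).
by rewrite !PB !PZ.
Qed.

Lemma proj_alternating_diffs_small e : 0 < e ->
  exists2 h0 : R, 0 < h0 & forall n k, (0 < n)%N -> mesh a b n < h0 ->
    (0 < k <= n)%N -> `|P (alternating_diffs a b y n k)| <= e / mesh a b n.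
Proof.
move=> e0.
have [h0 h00 small] := alternating_incr_small R v M proj_lipschitz a b e ab e0.
exists h0 => // -[//|n] [//|k] _ hh /= kn.
have hp := mesh_gt0 ab (ltn0Sn n).
have nh := mesh_mul _ (ltn0Sn n).
set h := mesh a b n.+1 in hh hp nh *.
have kb : a + k.+1%:R * h <= b.
  have : k.+1%:R * h <= n.+1%:R * h by rewrite ler_pM2r// ler_nat.
  lra.
have [tau] := alternating_second_diff R a b u v h k proj_continuous
  proj_is_derive hp kb.
rewrite in_itv/= => /andP[t0 th] E.
have -> : P (alternating_diffs a b y n.+1 k.+1) =
    (\sum_(0 <= i < k) (-1) ^+ i.+1 * incr R v (a + tau) h i) / h.
  (* Multiplication by [h ^+ 2] clears the denominators of the second difference quotients. *)
  apply: (mulfI (_ : h ^+ 2 != 0)); first by rewrite expf_neq0// gt_eqF.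
  rewrite (_ : _ * (_ / h) = h * \sum_(0 <= i < k) (-1) ^+ i.+1 * incr R v (a + tau) h i).
    rewrite -E /alternating_diffs proj_sum big_add1/= mulr_sumr.
    apply: eq_big_nat => i /andP[_ ik].
    rewrite proj_sign /second_diff projV -/h mulrCA; congr (_ * _).
    rewrite mulrC divfK ?expf_neq0 ?gt_eqF//.
    rewrite projD PB mulr2n projD -mulr2n /u /= -!/(node a b n.+1 _).
    by rewrite !clamp_id// node_itv//; lia.
  by field; rewrite gt_eqF.
rewrite normrM normfV (gtr0_norm hp) ler_pM2r ?invr_gt0//.
move: nh; rewrite -natr1 mulrDl mul1r => nh.
(* The grid starting at [a + tau] has only [n] of the [n.+1] cells inside [[a, b]]; one more would
   pass [b]. *)
by apply: (small _ _ n) => //; rewrite -?natr1 ?mulrDl ?mul1r; lra.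
Qed.

(** A single polynomial piece and the clamped [y] are continuous on the whole line; this serves the
    extreme value theorem on each cell. *)
Lemma proj_error_continuous n k :
  continuous (fun x => P (y (clamp R a b x) - spline_piece a b y n k x)).
Proof.
rewrite (_ : (fun x => _) = (fun x => u x -
  ((x - node a b n k.-1) * (P (y (node a b n k)) / mesh a b n)
   - (x - node a b n k) * (P (y (node a b n k.-1)) / mesh a b n)
   + (x - node a b n k.-1) * (x - node a b n k) * P (spline_coef a b y n k)))).
  move=> x; have xc (c : R) : (fun t => t - c) @ x --> x - c.
    by apply: cvgB; [exact: cvg_id|exact: cvg_cst].
  apply: cvgB; first exact: proj_continuous.
  apply: cvgD; first apply: cvgB; apply: cvgMl => //.
  exact: cvgM.
apply/funext => x; rewrite /spline_piece PB projD PB !PZ.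
by rewrite [_ * _%:C%C]mulrC PZ /u /=; ring.
Qed.

End Estimates.
End ComplexProjection.

(** * Bounds for the spline coefficients and the error, and existence of the maximum *)

Section SplineError.
Variables (R : realType) (a b M : R) (y y' y'' : R -> R[i]).
Hypothesis ab : a < b.
Hypothesis y_deriv : is_deriv_on a b y y'.
Hypothesis y'_deriv : is_deriv_on a b y' y''.
Hypothesis y''_le : forall x, x \in `[a, b] -> normc (y'' x) <= M.
Implicit Types (x e B : R) (n k j : nat).

Notation Re := (@complex.Re R).
Notation Im := (@complex.Im R).

Lemma ReB : {morph Re : z w / z - w}. Proof. by move=> [? ?] [? ?]. Qed.
Lemma ImB : {morph Im : z w / z - w}. Proof. by move=> [? ?] [? ?]. Qed.

Lemma ReZ (r : R) z : Re (r%:C%C * z) = r * Re z.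
Proof. by case: z => c d; rewrite /= mul0r subr0. Qed.

Lemma ImZ (r : R) z : Im (r%:C%C * z) = r * Im z.
Proof. by case: z => c d; rewrite /= mul0r addr0. Qed.

Lemma Re_le_normc z : `|Re z| <= normc z.
Proof. by case: z => c d; rewrite /= -sqrtr_sqr ler_wsqrtr// lerDl sqr_ge0. Qed.

Lemma Im_le_normc z : `|Im z| <= normc z.
Proof. by case: z => c d; rewrite /= -sqrtr_sqr ler_wsqrtr// lerDr sqr_ge0. Qed.

Lemma normc_le_ReIm (z : R[i]) : normc z <= `|Re z| + `|Im z|.
Proof.
case: z => c d /=; rewrite -(ger0_norm (addr_ge0 (normr_ge0 c) (normr_ge0 d))).
rewrite -sqrtr_sqr ler_wsqrtr// sqrrD !real_normK ?num_real//.
by rewrite addrAC lerDl mulrn_wge0// mulr_ge0.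
Qed.

Lemma normc_ge0 (z : R[i]) : 0 <= normc z.
Proof. by case: z => c d; exact: sqrtr_ge0. Qed.

Lemma normcD (z w : R[i]) : normc (z + w) <= normc z + normc w.
Proof. exact: le_normcD. Qed.

Lemma normc_sum (I : Type) (r : seq I) (F : I -> R[i]) :
  normc (\sum_(i <- r) F i) <= \sum_(i <- r) normc (F i).
Proof.
elim: r => [|i r IH]; first by rewrite !big_nil normc0.
by rewrite !big_cons (le_trans (normcD _ _))// lerD2l.
Qed.

Lemma normc_real (r : R) : normc r%:C%C = `|r|.
Proof. by rewrite /= expr0n addr0 sqrtr_sqr. Qed.

Lemma normc_sign m : normc ((-1) ^+ m : R[i]) = 1.
Proof. by rewrite -(rmorphN1 (real_complex R)) -rmorphXn normc_real normrX normrN1 expr1n. Qed.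

(** Double counting: [d j] occurs in the inner sums with [j < k <= n], which are [n - j] in
    number. *)
Lemma sum_weighted_abel (V : nzRingType) (d : nat -> V) n :
  \sum_(1 <= j < n) (n - j)%:R * d j =
  \sum_(1 <= k < n.+1) \sum_(1 <= j < k) d j.
Proof.
elim: n => [|n IH]; first by rewrite !big_geq.
rewrite [RHS]big_nat_recr//= -IH.
case: n {IH} => [|n]; first by rewrite !big_geq// addr0.
rewrite [LHS]big_nat_recr//= [X in _ = _ + X]big_nat_recr//=.
rewrite subSnn mul1r addrA; congr (_ + _).
rewrite -big_split/=; apply: eq_big_nat => j /andP[_ jn].
by rewrite subSn ?(ltnW jn)// -natr1 mulrDl mul1r.
Qed.

(** By Abel summation [a_1] is minus the mean of [T_1, ..., T_n], hence bounded by [B]; adding [T_k]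
    gives the factor 2. *)
Lemma spline_coef_le B n k :
  (forall j, (0 < j <= n)%N -> normc (alternating_diffs R a b y n j) <= B) ->
  (0 < k <= n)%N -> normc (spline_coef a b y n k) <= 2 * B.
Proof.
move=> H /[dup] kn /andP[k0 kn'].
have n0 : (0 < n)%N by exact: leq_trans k0 kn'.
have n0R : 0 < n%:R :> R by rewrite ltr0n.
rewrite /spline_coef normcM normc_sign mul1r (le_trans (normcD _ _))//.
rewrite mulrDl mul1r lerD ?H// normcN normcM.
have -> : normc (n%:R^-1 : R[i]) = n%:R^-1.
  by rewrite normcV -(rmorph_nat (real_complex R)) normc_real normr_nat.
rewrite ler_pdivrMl//.
under eq_bigr do rewrite -mulrA.
rewrite sum_weighted_abel (le_trans (normc_sum _ _ _))//.
apply: (@le_trans _ _ (\sum_(1 <= k < n.+1) B)).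
  by apply: ler_sum_nat => j; rewrite ltnS => jn; exact: H.
by rewrite big_const_nat iter_addr_0 subn1 mulr_natl.
Qed.

Lemma node_cover n x : (0 < n)%N -> x \in `[a, b] ->
  exists2 k, (k < n)%N & x \in `[node a b n k, node a b n k.+1].
Proof.
move=> n0; rewrite in_itv/= => /andP[ax xb].
have : x <= node a b n n by rewrite /node (mesh_mul R a b n n0) addrC subrK.
suff H m : (0 < m)%N -> x <= node a b n m ->
    exists2 k, (k < m)%N & x \in `[node a b n k, node a b n k.+1] by exact: H.
elim: m => [//|m IH] _ xm.
have [m0|m0] := posnP m.
  by exists 0%N; rewrite // in_itv/= {1}/node mul0r addr0 ax -m0.
have [xm'|/ltW mx] := leP x (node a b n m).
  by have [k km xI] := IH m0 xm'; exists k => //; exact: ltnW.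
by exists m => //; rewrite in_itv/= mx.
Qed.

(** The interpolation error is estimated for [Re] and [Im] separately, whence [2 * M]; the quadratic
    term is at most [2 * B] times [h ^+ 2 / 4]. *)
Lemma spline_error_le B n x : (0 < n)%N ->
  (forall j, (0 < j <= n)%N -> normc (alternating_diffs R a b y n j) <= B) ->
  x \in `[a, b] ->
  normc (y x - spline a b y n x) <=
    2 * M * mesh a b n ^+ 2 + B * mesh a b n ^+ 2 / 2.
Proof.
move=> n0 H xab; have [k kn xI] := node_cover _ _ n0 xab.
rewrite (splineE _ ab (k := k.+1))// /spline_piece /= opprD addrA.
have B0 : 0 <= B.
  by have := H 1%N; rewrite n0 => /(_ isT); apply: le_trans; exact: normc_ge0.
have h0 := mesh_gt0 ab n0.
apply: (le_trans (normcD _ _)); apply: lerD.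
  apply: (le_trans (normc_le_ReIm _)).
  have := proj_interp_error R Re ReB ReZ Re_le_normc a b M y y' y'' ab
    y_deriv y'_deriv y''_le n k x n0 kn xI.
  have := proj_interp_error R Im ImB ImZ Im_le_normc a b M y y' y'' ab
    y_deriv y'_deriv y''_le n k x n0 kn xI.
  lra.
rewrite normcN normcM normc_real.
have c2 := spline_coef_le B n k.+1 H kn.
have q4 : `|(x - node a b n k) * (x - node a b n k.+1)| <= mesh a b n ^+ 2 / 4.
  move: xI; rewrite in_itv/= => /andP[lx xr].
  rewrite -(nodeS R a b n k) ler0_norm; last by rewrite mulr_ge0_le0 ?subr_ge0 ?subr_le0.
  have := sqr_ge0 (x - node a b n k - (node a b n k.+1 - x)); lra.
apply: (@le_trans _ _ (2 * B * (mesh a b n ^+ 2 / 4))).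
  by apply: ler_pM => //; exact: normc_ge0.
lra.
Qed.

(** On one cell the spline is a single polynomial, so the extreme value theorem applies without any
    gluing of continuity at the nodes. *)
Lemma cell_max n k : (0 < n)%N -> (k < n)%N ->
  exists2 c, c \in `[node a b n k, node a b n k.+1] &
    forall t, t \in `[node a b n k, node a b n k.+1] ->
      normc (y t - spline a b y n t) <= normc (y c - spline a b y n c).
Proof.
move=> n0 kn.
pose z t := y (clamp R a b t) - spline_piece a b y n k.+1 t.
have zE t : t \in `[node a b n k, node a b n k.+1] -> z t = y t - spline a b y n t.
  move=> tI; rewrite (splineE _ ab (k := k.+1))// /z clamp_id//.
  have := node_itv _ _ _ ab n k n0 (ltnW kn); have := node_itv _ _ _ ab n k.+1 n0 kn.
  move: tI; rewrite !in_itv/= => /andP[lt tr] /andP[_ rb] /andP[al _].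
  by rewrite (le_trans al) ?(le_trans tr).
have zc : continuous (fun t => Num.sqrt (Re (z t) ^+ 2 + Im (z t) ^+ 2)).
  have Rc := proj_error_continuous R Re ReB ReZ Re_le_normc a b y y' ab y_deriv n k.+1.
  have Ic := proj_error_continuous R Im ImB ImZ Im_le_normc a b y y' ab y_deriv n k.+1.
  move=> t; apply: continuous_comp; last exact: sqrt_continuous.
  by apply: cvgD; apply: cvgM; [exact: Rc|exact: Rc|exact: Ic|exact: Ic].
have lr : node a b n k <= node a b n k.+1 by rewrite node_le.
have zw : {within `[node a b n k, node a b n k.+1],
    continuous (fun t => Num.sqrt (Re (z t) ^+ 2 + Im (z t) ^+ 2))}.
  by apply: continuous_subspaceT; exact: zc.
have [c cI cmax] := EVT_max lr zw.
exists c => // t tI; rewrite -!zE//.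
by have := cmax t tI; case: (z t) => ? ?; case: (z c).
Qed.

Lemma exists_max_error n : (0 < n)%N -> exists D, is_max_error a b y n D.
Proof.
move=> n0.
have /choice[c cP] (i : 'I_n) : exists c, c \in `[node a b n i, node a b n i.+1] /\
    forall t, t \in `[node a b n i, node a b n i.+1] ->
      normc (y t - spline a b y n t) <= normc (y c - spline a b y n c).
  by have [c cI cm] := cell_max n i n0 (ltn_ord i); exists c.
pose F i := normc (y (c i) - spline a b y n (c i)).
have [i _ imax] := @Order.TotalTheory.arg_maxP _ _ _ (Ordinal n0) xpredT F isT.
exists (F i); split.
  exists (c i) => //=; have [+ _] := cP i.
  have := node_itv _ _ _ ab n i n0 (ltnW (ltn_ord i)).
  have := node_itv _ _ _ ab n i.+1 n0 (ltn_ord i).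
  rewrite !in_itv/= => /andP[_ rb] /andP[al _] /andP[lc cr].
  by rewrite (le_trans al) ?(le_trans cr).
move=> _ [x xI <-]; have [k kn xk] := node_cover _ _ n0 xI.
have [_ km] := cP (Ordinal kn).
exact: le_trans (km x xk) (imax (Ordinal kn) isT).
Qed.

End SplineError.

(** * The explicit bound and the rate of convergence *)

Theorem mainTheorem2 (R : realType) (a b M : R) (y y' y'' : R -> R[i])
  (ab : a < b)
  (y_cont : {within `[a, b], continuous (y : R -> R[i]^o)})
  (y_deriv : is_deriv_on a b y y')
  (y'_deriv : is_deriv_on a b y' y'')
  (y''_le : forall x, x \in `[a, b] -> normc (y'' x) <= M)
  (second_diff_le : \forall n \near \oo,
    forall j : nat, (1 <= j <= n - 1)%N -> normc (second_diff a b y n j) <= M) :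
  exists D : nat -> R,
    [/\ forall n, (0 < n)%N -> is_max_error a b y n (D n),
        \forall n \near \oo,
          D n <= M * mesh a b n * (b - a - mesh a b n / 2)
      & D =o_\oo (mesh a b)].
Proof.
have M0 : 0 <= M.
  have := y''_le a; rewrite in_itv/= lexx ltW// => /(_ isT).
  by apply: le_trans; exact: normc_ge0.
have /choice[D DP] (n : nat) : exists d, (0 < n)%N -> is_max_error a b y n d.
  have [->|n0] := posnP n; first by exists 0.
  by have [d dP] := exists_max_error R a b y y' ab y_deriv n n0; exists d.
have D_le B n : (0 < n)%N ->
    (forall j, (0 < j <= n)%N -> normc (alternating_diffs R a b y n j) <= B) ->
    D n <= 2 * M * mesh a b n ^+ 2 + B * mesh a b n ^+ 2 / 2.
  move=> n0 HB; have [[x xI <-] _] := DP n n0.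
  exact: (spline_error_le R a b M y y' y'' ab y_deriv y'_deriv y''_le).
have mesh_small (e : R) : 0 < e -> \forall n \near \oo, mesh a b n < e.
  move=> e0; exists (Num.truncn ((b - a) / e)).+1 => // n /= Nn.
  have n0 : (0 < n)%N by exact: leq_trans Nn.
  rewrite /mesh ltr_pdivrMr ?ltr0n// mulrC -ltr_pdivrMr//.
  by apply: lt_le_trans (truncnS_gt _) _; rewrite ler_nat.
exists D; split => //.
  near=> n.
  (* The general bound with [B = n * M] is [M * h ^+ 2 * (2 + n / 2)] and the target is
     [M * h ^+ 2 * (n - 1 / 2)]; they compare exactly when [n >= 5], unless [M = 0]. *)
  have n5 : (5 <= n)%N by near: n; exact: nbhs_infty_ge.
  have n0 : (0 < n)%N by exact: leq_trans n5.
  have sd : forall j : nat, (1 <= j <= n - 1)%N -> normc (second_diff a b y n j) <= M.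
    by near: n.
  apply: (le_trans (D_le (n%:R * M) n n0 _)).
    move=> j /andP[j0 jn]; apply: (le_trans (normc_sum _ _ _ _)).
    apply: (@le_trans _ _ (\sum_(1 <= i < j) M)).
      apply: ler_sum_nat => i /andP[i1 ij]; rewrite normcM normc_sign mul1r sd// i1/=.
      by rewrite leq_subRL ?add1n ?(leq_trans ij)// (leq_ltn_trans i1).
    rewrite big_const_nat iter_addr_0 -[leLHS]mulr_natl ler_wpM2r// ler_nat.
    exact: leq_trans (leq_subr _ _) jn.
  have <- := mesh_mul R a b n n0.
  have : 5%:R <= n%:R :> R by rewrite ler_nat.
  set h := mesh a b n; move=> n5R.
  have : 0 <= M * h ^+ 2 * (n%:R - 5%:R) by rewrite mulr_ge0 ?subr_ge0// mulr_ge0 ?sqr_ge0.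
  have : 0 <= M * h ^+ 2 by rewrite mulr_ge0 ?sqr_ge0.
  lra.
apply/eqoP => e e0.
(* Real and imaginary parts each contribute [e / (4 * h)] to the bound on [T_k], so the quadratic
   term of the error is at most [e * h / 4]. *)
have e4 : 0 < e / 4 by rewrite divr_gt0.
have [h1 h10 H1] := proj_alternating_diffs_small R (@complex.Re R) (ReB R) (ReZ R)
  (Re_le_normc R)
  a b M y y' y'' ab y_deriv y'_deriv y''_le _ e4.
have [h2 h20 H2] := proj_alternating_diffs_small R (@complex.Im R) (ImB R) (ImZ R)
  (Im_le_normc R)
  a b M y y' y'' ab y_deriv y'_deriv y''_le _ e4.
have K0 : 0 < 4 * M + 1 by rewrite ltr_wpDl// mulr_ge0.
near=> n.
have n0 : (0 < n)%N by near: n; exact: nbhs_infty_gt.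
have hp := mesh_gt0 ab n0.
have mh1 : mesh a b n < h1 by near: n; exact: mesh_small.
have mh2 : mesh a b n < h2 by near: n; exact: mesh_small.
(* This makes the interpolation term [2 * M * h ^+ 2] at most [e * h / 2]; the added 1 covers
   [M = 0]. *)
have mhe : mesh a b n < e / (4 * M + 1).
  by near: n; apply: mesh_small; rewrite divr_gt0.
rewrite ltr_pdivlMr// in mhe.
have D0 : 0 <= D n.
  by have [[x _ <-] _] := DP n n0; exact: normc_ge0.
rewrite (ger0_norm D0) (gtr0_norm hp).
apply: (le_trans (D_le (e / 2 / mesh a b n) n n0 _)).
  move=> j jn; apply: (le_trans (normc_le_ReIm _ _)).
  have := H1 n j n0 mh1 jn; have := H2 n j n0 mh2 jn.
  have -> : e / 2 / mesh a b n = e / 4 / mesh a b n + e / 4 / mesh a b n.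
    by field; rewrite gt_eqF.
  lra.
have -> : e / 2 / mesh a b n * mesh a b n ^+ 2 / 2 = e / 4 * mesh a b n.
  by field; rewrite gt_eqF.
nra.
Unshelve. all: by end_near. Qed.
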